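(* Let $G$ and $H$ be groups and let $F$ be a field. Then the group algebra $F(F^{\times}\times G\times H)$ is the (categorical) product of the group algebras $FG$ and $FH$ (all with the standard gradings) in both categories $\widetilde{\mathbf{GrAlg}_F}$ and $\widetilde{\mathbf{GrAlg}^1_F}$.
   Context: Algebras are associative over the field $F$, not necessarily unital or commutative. A grading on an algebra $A$ by a group $G$ is a decomposition $A=\bigoplus_{g\in G}A^{(g)}$ into a direct sum of subspaces with $A^{(g)}A^{(h)}\subseteq A^{(gh)}$ for all $g,h\in G$. A homomorphism of algebras $\psi\colon A\to B$ between algebras graded by groups $G$ and $H$ (possibly different) is graded if for every $g\in G$ there exists $h\in H$ with $\psi(A^{(g)})\subseteq B^{(h)}$. A graded homomorphism is graded injective if its restriction to each homogeneous component $A^{(g)}$ is injective. $\widetilde{\mathbf{GrAlg}_F}$ is the category whose objects are all gradings by arbitrary groups on (not necessarily unital) associative $F$-algebras and whose morphisms are the graded injective homomorphisms. $\widetilde{\mathbf{GrAlg}^1_F}$ is the category whose objects are all group gradings on unital associative $F$-algebras and whose morphisms are the unital graded injective homomorphisms. For a group $G$, $FG$ denotes the group algebra with standard basis $(u_g)_{g\in G}$; its standard grading is the $G$-grading with $(FG)^{(g)}=Fu_g$. $F^\times$ is the multiplicative group of $F$. *)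

(* Defs.v *)
From HB Require Import structures.
From mathcomp Require Import all_boot all_algebra finmap.
From mathcomp.multinomials Require Import monalg.
From Stdlib Require Import ProofIrrelevance.

Set Implicit Arguments.
Unset Strict Implicit.
Unset Printing Implicit Defensive.

Import GRing.Theory.
Local Open Scope fset_scope.
Local Open Scope ring_scope.

Record category := Category {
  obj :> Type;
  hom : obj -> obj -> Type;
  idm : forall A, hom A A;
  comp : forall A B C, hom B C -> hom A B -> hom A C;
  comp_idl : forall A B (f : hom A B), comp (idm B) f = f;
  comp_idr : forall A B (f : hom A B), comp f (idm A) = f;
  comp_assoc : forall A B C D (h : hom C D) (g : hom B C) (f : hom A B),
    comp h (comp g f) = comp (comp h g) f
}.

Arguments hom {c} A B.
Arguments idm {c} A.
Arguments comp {c A B C} g f.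

Definition is_product_cone (C : category) (A B P : C)
    (p1 : hom P A) (p2 : hom P B) : Prop :=
  forall (X : C) (f : hom X A) (g : hom X B),
    exists! h : hom X P, comp p1 h = f /\ comp p2 h = g.

Definition is_product (C : category) (A B P : C) : Prop :=
  exists (p1 : hom P A) (p2 : hom P B), is_product_cone p1 p2.

(** The algebras of MathComp ([algType]) are unital and nonzero, hence the
    structures below, which only assume an associative bilinear product.  The
    zero algebra is an [assocAlgType], and also a [unitalAlgType]. *)

HB.mixin Record Lmodule_isAssocAlgebra (F : fieldType) A
    of GRing.Lmodule F A := {
  amul : A -> A -> A;
  amulA : associative amul;
  amulDl : left_distributive amul +%R;
  amulDr : right_distributive amul +%R;
  amulZl : forall (k : F) (a b : A), amul (k *: a) b = k *: amul a b;
  amulZr : forall (k : F) (a b : A), amul a (k *: b) = k *: amul a b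
}.

#[short(type="assocAlgType")]
HB.structure Definition AssocAlgebra (F : fieldType) :=
  { A of Lmodule_isAssocAlgebra F A & GRing.Lmodule F A }.

HB.mixin Record AssocAlgebra_isUnital (F : fieldType) A
    of AssocAlgebra F A := {
  aone : A;
  amul1a : left_id aone (@amul F A);
  amula1 : right_id aone (@amul F A)
}.

#[short(type="unitalAlgType")]
HB.structure Definition UnitalAlgebra (F : fieldType) :=
  { A of AssocAlgebra_isUnital F A & AssocAlgebra F A }.

(** A decomposition [A = (+)_g A^(g)] is expressed by the existence and
    uniqueness, for each [a], of a finitely supported family of homogeneous
    components with sum [a]. *)

Record grading (F : fieldType) (A : assocAlgType F) (G : groupType) :=
  Grading {
    component :> G -> {pred A};
    component_submod : forall g, submod_closed (component g);
    component_direct_sum : forall a : A, exists! f : {fsfun G -> A with 0},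
      (forall g, f g \in component g) /\ a = \sum_(g <- finsupp f) f g;
    component_mul : forall g h (a b : A),
      a \in component g -> b \in component h ->
      amul a b \in component (g * h)%g
  }.

Section Morphisms.
Variables (F : fieldType) (A B : assocAlgType F) (G H : groupType).
Variables (GA : grading A G) (GB : grading B H).

Definition is_alghom (f : A -> B) : Prop :=
  linear f /\ {morph f : x y / amul x y >-> amul x y}.

Definition graded (f : A -> B) : Prop :=
  forall g, exists h, {in GA g, forall a, f a \in GB h}.

Definition graded_injective (f : A -> B) : Prop :=
  is_alghom f /\ graded f /\ forall g, {in GA g &, injective f}.

End Morphisms.

Arguments graded_injective {F A B G H} GA GB f.

Lemma graded_injective_id (F : fieldType) (A : assocAlgType F)
  (G : groupType) (GA : grading A G) : graded_injective GA GA idfun.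
Proof. by split=> //; split=> g; [exists g | move=> a b _ _]. Qed.

Lemma graded_injective_comp (F : fieldType) (A B C : assocAlgType F)
  (G H K : groupType) (GA : grading A G) (GB : grading B H)
  (GC : grading C K) (g : B -> C) (f : A -> B) :
  graded_injective GB GC g -> graded_injective GA GB f ->
  graded_injective GA GC (g \o f).
Proof.
move=> [[glin gmul] [ggr ginj]] [[flin fmul] [fgr finj]].
split; first by split=> [k x y|x y] /=; rewrite ?flin ?glin ?fmul ?gmul.
split=> x; have [y fy] := fgr x.
  by have [z gz] := ggr y; exists z => a /fy /gz.
move=> a b Aa Ab /= eq_ab; apply: (finj x) => //.
by apply: (ginj y) => //; apply: fy.
Qed.

Record grAlg (F : fieldType) := GrAlg {
  gr_alg :> assocAlgType F;
  gr_group : groupType;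
  gr_grading : grading gr_alg gr_group
}.

Definition grAlg_hom (F : fieldType) (A B : grAlg F) : Type :=
  {f : A -> B | graded_injective (gr_grading A) (gr_grading B) f}.

Section GrAlgCategory.
Variable F : fieldType.
Implicit Types A B C D : grAlg F.

Definition grAlg_id A : grAlg_hom A A :=
  exist _ idfun (graded_injective_id _).

Definition grAlg_comp A B C (g : grAlg_hom B C) (f : grAlg_hom A B) :
    grAlg_hom A C :=
  exist _ (sval g \o sval f) (graded_injective_comp (svalP g) (svalP f)).

Lemma grAlg_comp_idl A B (f : grAlg_hom A B) : grAlg_comp (grAlg_id B) f = f.
Proof. by case: f => f fP; apply: subset_eq_compat. Qed.

Lemma grAlg_comp_idr A B (f : grAlg_hom A B) : grAlg_comp f (grAlg_id A) = f.
Proof. by case: f => f fP; apply: subset_eq_compat. Qed.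

Lemma grAlg_comp_assoc A B C D (h : grAlg_hom C D) (g : grAlg_hom B C)
    (f : grAlg_hom A B) :
  grAlg_comp h (grAlg_comp g f) = grAlg_comp (grAlg_comp h g) f.
Proof. exact: subset_eq_compat. Qed.

Definition GrAlgCat : category :=
  Category grAlg_comp_idl grAlg_comp_idr grAlg_comp_assoc.

End GrAlgCategory.

Record grAlg1 (F : fieldType) := GrAlg1 {
  gr1_alg :> unitalAlgType F;
  gr1_group : groupType;
  gr1_grading : grading gr1_alg gr1_group
}.

Definition grAlg1_hom (F : fieldType) (A B : grAlg1 F) : Type :=
  {f : A -> B | graded_injective (gr1_grading A) (gr1_grading B) f /\
                f aone = aone}.

Section GrAlg1Category.
Variable F : fieldType.
Implicit Types A B C D : grAlg1 F.

Definition grAlg1_id A : grAlg1_hom A A :=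
  exist _ idfun (conj (graded_injective_id _) erefl).

Definition grAlg1_comp A B C (g : grAlg1_hom B C) (f : grAlg1_hom A B) :
    grAlg1_hom A C :=
  exist _ (sval g \o sval f)
    (conj (graded_injective_comp (svalP g).1 (svalP f).1)
          (etrans (congr1 (sval g) (svalP f).2) (svalP g).2)).

Lemma grAlg1_comp_idl A B (f : grAlg1_hom A B) :
  grAlg1_comp (grAlg1_id B) f = f.
Proof. by case: f => f fP; apply: subset_eq_compat. Qed.

Lemma grAlg1_comp_idr A B (f : grAlg1_hom A B) :
  grAlg1_comp f (grAlg1_id A) = f.
Proof. by case: f => f fP; apply: subset_eq_compat. Qed.

Lemma grAlg1_comp_assoc A B C D (h : grAlg1_hom C D) (g : grAlg1_hom B C)
    (f : grAlg1_hom A B) :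
  grAlg1_comp h (grAlg1_comp g f) = grAlg1_comp (grAlg1_comp h g) f.
Proof. exact: subset_eq_compat. Qed.

Definition GrAlg1Cat : category :=
  Category grAlg1_comp_idl grAlg1_comp_idr grAlg1_comp_assoc.

End GrAlg1Category.

(** [{unit F}] is only available in MathComp for finite rings. *)

Definition funit (F : fieldType) := {x : F | x != 0}.

Section FieldUnits.
Variable F : fieldType.
Implicit Types x y z : funit F.

HB.instance Definition _ := SubChoice.on (funit F).

Definition funit_one : funit F := exist _ 1 (oner_neq0 F).
Definition funit_mul x y : funit F :=
  exist _ (val x * val y) (mulf_neq0 (valP x) (valP y)).
Definition funit_inv x : funit F :=
  exist _ (val x)^-1 (invr_neq0 (valP x)).

Lemma funit_mulA : associative funit_mul.
Proof. by move=> x y z; apply: val_inj; rewrite /= mulrA. Qed.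

Lemma funit_mul1 : left_id funit_one funit_mul.
Proof. by move=> x; apply: val_inj; rewrite /= mul1r. Qed.

Lemma funit_mulr1 : right_id funit_one funit_mul.
Proof. by move=> x; apply: val_inj; rewrite /= mulr1. Qed.

Lemma funit_mulV : left_inverse funit_one funit_inv funit_mul.
Proof. by move=> x; apply: val_inj; rewrite /= mulVf ?(valP x). Qed.

Lemma funit_mulrV : right_inverse funit_one funit_inv funit_mul.
Proof. by move=> x; apply: val_inj; rewrite /= mulfV ?(valP x). Qed.

HB.instance Definition _ := isGroup.Build (funit F)
  funit_mulA funit_mul1 funit_mulr1 funit_mulV funit_mulrV.

End FieldUnits.

(** The product that [monalg] puts on [{malg F[K]}] requires [K] to be a
    [monomType], i.e. a monoid without nontrivial invertible elements, which
    excludes groups; only its [F]-module structure is reused here. *)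

Definition galg (F : fieldType) (G : groupType) := {malg F[G]}.

Section GroupAlgebra.
Variables (F : fieldType) (G : groupType).

HB.instance Definition _ := GRing.Lmodule.on (galg F G).

Implicit Types (x y z : galg F G) (g h : G).

Definition gbasis g : galg F G := << 1 *g g >>.

Definition galg_mul x y : galg F G :=
  \sum_(g <- msupp x) \sum_(h <- msupp y) (x@_g * y@_h) *: gbasis (g * h)%g.

Lemma gbasisE (c : F) g : c *: gbasis g = << c *g g >>.
Proof. by apply/malgP=> k; rewrite mcoeffZ !mcoeffU mulrnAr mulr1. Qed.

Lemma galg_mulw (D E : {fset G}) x y : msupp x `<=` D -> msupp y `<=` E ->
  galg_mul x y =
  \sum_(g <- D) \sum_(h <- E) (x@_g * y@_h) *: gbasis (g * h)%g.
Proof.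
move=> xD yE; rewrite /galg_mul (big_fset_incl _ xD) /=.
  apply: eq_bigr => g _; apply: big_fset_incl => // h _ /mcoeff_outdom ->.
  by rewrite mulr0 scale0r.
by move=> g _ /mcoeff_outdom ->; rewrite big1 // => h _; rewrite mul0r scale0r.
Qed.

Lemma galg_mulDl : left_distributive galg_mul +%R.
Proof.
move=> x y z.
rewrite (galg_mulw (msuppD_le x y) (fsubset_refl (msupp z))).
rewrite (galg_mulw (fsubsetUl (msupp x) (msupp y)) (fsubset_refl (msupp z))).
rewrite (galg_mulw (fsubsetUr (msupp x) (msupp y)) (fsubset_refl (msupp z))).
rewrite -big_split /=; apply: eq_bigr => g _.
rewrite -big_split /=; apply: eq_bigr => h _.
by rewrite mcoeffD mulrDl scalerDl.
Qed.

Lemma galg_mulDr : right_distributive galg_mul +%R.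
Proof.
move=> z x y.
rewrite (galg_mulw (fsubset_refl (msupp z)) (msuppD_le x y)).
rewrite (galg_mulw (fsubset_refl (msupp z)) (fsubsetUl (msupp x) (msupp y))).
rewrite (galg_mulw (fsubset_refl (msupp z)) (fsubsetUr (msupp x) (msupp y))).
rewrite -big_split /=; apply: eq_bigr => g _.
rewrite -big_split /=; apply: eq_bigr => h _.
by rewrite mcoeffD mulrDr scalerDl.
Qed.

Lemma galg_mulZl (k : F) x y : galg_mul (k *: x) y = k *: galg_mul x y.
Proof.
rewrite (galg_mulw (msuppZ_le k x) (fsubset_refl (msupp y))) scaler_sumr.
apply: eq_bigr => g _; rewrite scaler_sumr; apply: eq_bigr => h _.
by rewrite mcoeffZ scalerA mulrA.
Qed.

Lemma galg_mulZr (k : F) x y : galg_mul x (k *: y) = k *: galg_mul x y.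
Proof.
rewrite (galg_mulw (fsubset_refl (msupp x)) (msuppZ_le k y)) scaler_sumr.
apply: eq_bigr => g _; rewrite scaler_sumr; apply: eq_bigr => h _.
by rewrite mcoeffZ scalerA mulrCA.
Qed.

Lemma galg_mul0x x : galg_mul 0 x = 0.
Proof. by rewrite -(scale0r (0 : galg F G)) galg_mulZl !scale0r. Qed.

Lemma galg_mulx0 x : galg_mul x 0 = 0.
Proof. by rewrite -(scale0r (0 : galg F G)) galg_mulZr !scale0r. Qed.

Lemma galg_mul_basis g h : galg_mul (gbasis g) (gbasis h) = gbasis (g * h)%g.
Proof.
rewrite /galg_mul !msuppU oner_eq0 !big_seq_fset1 !mcoeffUU mulr1.
by rewrite scale1r.
Qed.

Lemma galg_sum x : x = \sum_(g <- msupp x) x@_g *: gbasis g.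
Proof. by rewrite [LHS]monalgE; apply: eq_bigr => g _; rewrite gbasisE. Qed.

Lemma galg_ind (P : galg F G -> Prop) :
  P 0 -> (forall x y, P x -> P y -> P (x + y)) ->
  (forall c g, P (c *: gbasis g)) -> forall x, P x.
Proof.
move=> P0 PD PU x; rewrite (galg_sum x).
by elim/big_ind: _ => // g _; apply: PU.
Qed.

Lemma galg_mulA : associative galg_mul.
Proof.
move=> x y z.
elim/galg_ind: x => [|x1 x2 IH1 IH2|c g]; first by rewrite !galg_mul0x.
  by rewrite !galg_mulDl IH1 IH2.
elim/galg_ind: y => [|y1 y2 IH1 IH2|d h].
- by rewrite galg_mul0x galg_mulx0 galg_mul0x.
- by rewrite galg_mulDl !galg_mulDr galg_mulDl IH1 IH2.
elim/galg_ind: z => [|z1 z2 IH1 IH2|e k]; first by rewrite !galg_mulx0.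
  by rewrite !galg_mulDr IH1 IH2.
have mulZZ (a b : F) (u v : galg F G) :
    galg_mul (a *: u) (b *: v) = (a * b) *: galg_mul u v.
  by rewrite galg_mulZl galg_mulZr scalerA.
by rewrite !mulZZ !galg_mul_basis mulgA mulrA.
Qed.

Lemma galg_mul1x : left_id (gbasis 1%g) galg_mul.
Proof.
elim/galg_ind => [|x y IHx IHy|c g]; first by rewrite galg_mulx0.
  by rewrite galg_mulDr IHx IHy.
by rewrite galg_mulZr galg_mul_basis mul1g.
Qed.

Lemma galg_mulx1 : right_id (gbasis 1%g) galg_mul.
Proof.
elim/galg_ind => [|x y IHx IHy|c g]; first by rewrite galg_mul0x.
  by rewrite galg_mulDl IHx IHy.
by rewrite galg_mulZl galg_mul_basis mulg1.
Qed.

HB.instance Definition _ := Lmodule_isAssocAlgebra.Build F (galg F G)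
  galg_mulA galg_mulDl galg_mulDr galg_mulZl galg_mulZr.
HB.instance Definition _ := AssocAlgebra_isUnital.Build F (galg F G)
  galg_mul1x galg_mulx1.

(** The line [F u_g], in decidable form: see [std_componentP]. *)
Definition std_component g : {pred galg F G} :=
  [pred x : galg F G | x == x@_g *: gbasis g].

Lemma std_componentP g x :
  reflect (exists c : F, x = c *: gbasis g) (x \in std_component g).
Proof.
apply: (iffP eqP) => [->|[c ->]]; first by exists x@_g.
by rewrite mcoeffZ mcoeffUU mulr1.
Qed.

Lemma std_component_submod g : submod_closed (std_component g).
Proof.
split; first by apply/std_componentP; exists 0; rewrite scale0r.
move=> k _ _ /std_componentP[c ->] /std_componentP[d ->].
by apply/std_componentP; exists (k * c + d); rewrite scalerA scalerDl.
Qed.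

Lemma std_component_mul g h x y :
  x \in std_component g -> y \in std_component h ->
  amul x y \in std_component (g * h)%g.
Proof.
move=> /std_componentP[c ->] /std_componentP[d ->].
apply/std_componentP; exists (c * d).
by rewrite amulZl amulZr scalerA; congr (_ *: _); apply: galg_mul_basis.
Qed.

Lemma std_component_direct_sum x : exists! f : {fsfun G -> galg F G with 0},
  (forall g, f g \in std_component g) /\ x = \sum_(g <- finsupp f) f g.
Proof.
pose f : {fsfun G -> galg F G with 0} :=
  [fsfun g in msupp x => x@_g *: gbasis g | 0].
have fE g : f g = x@_g *: gbasis g.
  rewrite fsfunE; case: ifPn => // /mcoeff_outdom ->; by rewrite scale0r.
exists f; split.
  split=> [g|]; first by apply/std_componentP; exists x@_g.
  rewrite [LHS]galg_sum.
  have fx : finsupp f `<=` msupp x by apply: finsupp_sub.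
  rewrite (big_fset_incl _ fx) /=; first by apply: eq_bigr => g _; rewrite fE.
  by move=> g _ /fsfun_dflt.
move=> f' [f'hom xE]; apply/fsfunP => g; rewrite fE {1}xE.
have -> : (\sum_(h <- finsupp f') f' h)@_g = (f' g)@_g.
  rewrite raddf_sum /=; have [gf|gf] := boolP (g \in finsupp f').
    rewrite (big_fsetD1 g) //= big1_fset ?addr0 // => h.
    rewrite in_fsetD1 => /andP[hg _] _; have /std_componentP[c ->] := f'hom h.
    by rewrite mcoeffZ mcoeffU (negbTE hg) mulr0.
  rewrite (fsfun_dflt gf) mcoeff0 big1_fset // => h hf _.
  have /std_componentP[c ->] := f'hom h; rewrite mcoeffZ mcoeffU.
  by case: eqP hf gf => [->|_ _ _]; [move=> -> | rewrite mulr0].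
by apply/esym/eqP; exact: f'hom.
Qed.

Definition std_grading : grading (galg F G) G :=
  Grading std_component_submod std_component_direct_sum std_component_mul.

Definition group_grAlg : GrAlgCat F := GrAlg std_grading.
Definition group_grAlg1 : GrAlg1Cat F := GrAlg1 std_grading.

End GroupAlgebra.

(* Main.v *)
Require Import Defs.
From HB Require Import structures.
From mathcomp Require Import all_boot all_algebra finmap.
From mathcomp.multinomials Require Import monalg.
From Stdlib Require Import Classical IndefiniteDescription.
From Stdlib Require Import FunctionalExtensionality ProofIrrelevance.

(** The projections are [p1 : u_(a, g, h) |-> a u_g] and
    [p2 : u_(a, g, h) |-> u_h].  The factor [F^x] is forced by the following
    remark.  Let [f : X -> FG] and [g : X -> FH] be graded injective.  A
    homogeneous component of [X] embeds into a line [F u_i] and into a line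
    [F u_j], so it has dimension at most one, and on it [f] and [g] are
    proportional: if [x0] is a nonzero element with [f x0 = a u_i] and
    [g x0 = b u_j], then the ratio [a / b] depends only on the component.  A
    map into the product that lies over [f] and [g] therefore has to send this
    component into [F u_(a / b, i, j)], by [x0 |-> b u_(a / b, i, j)]
    ([component_degree]).

    The projections are not jointly injective on the whole group algebra, but
    they are on homogeneous elements, even of different degrees
    ([homogeneous_jointly_monic]): [p2] recovers the coefficient and [j], then
    [p1] recovers [i] and the ratio.  This gives uniqueness at once, since a
    linear map is determined by its values on homogeneous elements.  It also
    gives multiplicativity of the map just described: for homogeneous [x] and
    [y], the image of [x y] and the product of the images are homogeneous,
    and they have the same projections because [f] and [g] are multiplicative.
    [grading_extension] turns the componentwise data into an algebra map.

    In the unital category it remains to see that the factorization preserves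
    the unit.  A nonzero homogeneous element of a group algebra is invertible,
    so any nonzero graded injective homomorphism from a unital algebra into a
    group algebra is unital ([graded_injective_unital]). *)

Set Implicit Arguments.
Unset Strict Implicit.
Unset Printing Implicit Defensive.

Import GRing.Theory.
Local Open Scope fset_scope.
Local Open Scope ring_scope.

(** * Linear maps out of a graded algebra *)

Lemma linear_props (F : fieldType) (U V : lmodType F) (f : U -> V) :
  linear f -> [/\ f 0 = 0, {morph f : x y / x + y} &
                  forall c x, f (c *: x) = c *: f x].
Proof.
move=> flin.
pose fL : {linear U -> V} := HB.pack f (GRing.isLinear.Build F U V *:%R f flin).
by split=> [|x y|c x]; rewrite -[f]/(fL : _ -> _) (linear0, linearD, linearZ).
Qed.

Lemma amul0x (F : fieldType) (A : assocAlgType F) (x : A) : amul 0 x = 0.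
Proof. by rewrite -(scale0r (0 : A)) amulZl !scale0r. Qed.

Lemma amulx0 (F : fieldType) (A : assocAlgType F) (x : A) : amul x 0 = 0.
Proof. by rewrite -(scale0r (0 : A)) amulZr !scale0r. Qed.

Lemma finsupp_single_sub (K : choiceType) (V : eqType) (v0 : V) k v :
  finsupp ([fsfun [fsfun] with k |-> v] : {fsfun K -> V with v0}) `<=` [fset k].
Proof.
apply/fsubsetP => l; rewrite mem_finsupp fsfun_withE in_fset1.
by case: ifP => //; rewrite fsfun0E eqxx.
Qed.

Section GradedAlgebra.
Variables (F : fieldType) (A : assocAlgType F) (K : groupType).
Variable GA : grading A K.

Lemma component0 k : 0 \in GA k.
Proof. by have [] := component_submod GA k. Qed.

Lemma componentZ k (c : F) a : a \in GA k -> c *: a \in GA k.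
Proof.
have [A0 AD] := component_submod GA k => Aa.
by rewrite -[_ *: _]addr0; apply: AD.
Qed.

Lemma grading_ind (P : A -> Prop) :
  P 0 -> (forall a b, P a -> P b -> P (a + b)) ->
  (forall k a, a \in GA k -> P a) -> forall a, P a.
Proof.
move=> P0 PD Phom a; have [d [[dhom ->] _]] := component_direct_sum GA a.
by elim/big_ind: _ => // k _; apply: Phom (dhom k).
Qed.

Lemma linear_eq_homogeneous (B : assocAlgType F) (f g : A -> B) :
  linear f -> linear g -> (forall k, {in GA k, f =1 g}) -> f =1 g.
Proof.
move=> /linear_props[f0 fD _] /linear_props[g0 gD _] fg.
elim/grading_ind => [|a b IHa IHb|k a /fg //]; first by rewrite f0 g0.
by rewrite fD gD IHa IHb.
Qed.

(** Linearity of the homogeneous components comes from their uniqueness: the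
    combination of the decompositions of [a] and [b] is a decomposition of the
    combination of [a] and [b]. *)
Lemma grading_decomposition : exists d : A -> {fsfun K -> A with 0},
  [/\ forall a k, d a k \in GA k,
      forall k (c : F) a b, d (c *: a + b) k = c *: d a k + d b k &
      forall k a, a \in GA k -> d a = [fsfun [fsfun] with k |-> a]].
Proof.
pose R a (d : {fsfun K -> A with 0}) :=
  (forall k, d k \in GA k) /\ a = \sum_(k <- finsupp d) d k.
have Runiq a d d' : R a d -> R a d' -> d = d'.
  move=> Rd Rd'; have [e [_ eU]] := component_direct_sum GA a.
  by rewrite -(eU d Rd) -(eU d' Rd').
have [d dP] : exists d, forall a, R a (d a).
  apply: functional_choice => a.
  by have [d [dP _]] := component_direct_sum GA a; exists d.
have sumW (S : {fset K}) (e : {fsfun K -> A with 0}) : finsupp e `<=` S ->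
    \sum_(k <- finsupp e) e k = \sum_(k <- S) e k.
  by move=> eS; apply: big_fset_incl => // k _ /fsfun_dflt.
exists d; split=> [a k|k c a b|k a Aa]; first by case: (dP a).
  pose S := finsupp (d a) `|` finsupp (d b).
  pose e : {fsfun K -> A with 0} :=
    [fsfun k in S => c *: d a k + d b k | 0].
  have eE l : e l = c *: d a l + d b l.
    rewrite fsfunE; case: ifPn => //; rewrite in_fsetU negb_or => /andP[la lb].
    by rewrite !fsfun_dflt // scaler0 addr0.
  rewrite -eE; congr (fun_of_fsfun _ _); apply: Runiq (dP _) _.
  split=> [l|].
    rewrite eE; have [_ AD] := component_submod GA l.
    by apply: AD; [case: (dP a) | case: (dP b)].
  rewrite (sumW S e) ?finsupp_sub //.
  under eq_bigr do rewrite eE.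
  rewrite big_split /= -scaler_sumr -!sumW ?fsubsetUl ?fsubsetUr //.
  by have [_ <-] := dP a; have [_ <-] := dP b.
apply: Runiq (dP _) _; split=> [l|].
  by rewrite fsfun_withE; case: eqP => [->|_] //; rewrite fsfun0E component0.
by rewrite (sumW _ _ (finsupp_single_sub 0 k a)) big_seq_fset1 fsfun_with.
Qed.

(** The extension sums the values of [phi k] at the homogeneous components.  By
    bilinearity of the product, its multiplicativity can be tested on
    homogeneous elements. *)
Lemma grading_extension (B : assocAlgType F) (phi : K -> A -> B) :
  (forall k, linear (phi k)) ->
  (forall k l a b, a \in GA k -> b \in GA l ->
     phi (k * l)%g (amul a b) = amul (phi k a) (phi l b)) ->
  exists Phi : A -> B, is_alghom Phi /\ forall k, {in GA k, Phi =1 phi k}.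
Proof.
move=> philin phimul.
have phi0 k : phi k 0 = 0 by have [] := linear_props (philin k).
have [d [dhom dlin dhomE]] := grading_decomposition.
(* All the sums are extended to a common finite set containing the supports. *)
pose Phi a := \sum_(k <- finsupp (d a)) phi k (d a k).
have PhiW (S : {fset K}) a : finsupp (d a) `<=` S ->
    Phi a = \sum_(k <- S) phi k (d a k).
  move=> aS; apply: big_fset_incl => // k _ /fsfun_dflt ->; exact: phi0.
have PhiE k a : a \in GA k -> Phi a = phi k a.
  move=> /dhomE da; rewrite (PhiW [fset k]) da ?finsupp_single_sub //.
  by rewrite big_seq_fset1 fsfun_with.
have Philin : linear Phi.
  move=> c a b.
  pose S := finsupp (d (c *: a + b)) `|` (finsupp (d a) `|` finsupp (d b)).
  have SU : finsupp (d a) `|` finsupp (d b) `<=` S by apply: fsubsetUr.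
  rewrite !(PhiW S) ?fsubsetUl ?(fsubset_trans _ SU) ?fsubsetUl ?fsubsetUr //.
  rewrite scaler_sumr -big_split /=; apply: eq_bigr => k _.
  by rewrite dlin philin.
exists Phi; split=> //; split=> // a b.
have [Phi0 PhiD _] := linear_props Philin.
elim/grading_ind: a => [|a1 a2 IH1 IH2|k a Aa].
- by rewrite amul0x Phi0 amul0x.
- by rewrite amulDl !PhiD IH1 IH2 amulDl.
elim/grading_ind: b => [|b1 b2 IH1 IH2|l b Ab].
- by rewrite amulx0 Phi0 amulx0.
- by rewrite amulDr !PhiD IH1 IH2 amulDr.
by rewrite (PhiE _ _ (component_mul Aa Ab)) phimul // (PhiE k) // (PhiE l).
Qed.

End GradedAlgebra.

(** * Group algebras *)

Section Basis.
Variables (F : fieldType) (G : groupType).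

Lemma scale_gbasis_eq0 (c : F) (g : G) : c *: gbasis F g = 0 -> c = 0.
Proof.
by move=> /(congr1 (mcoeff g)); rewrite mcoeffZ mcoeffUU mulr1 mcoeff0.
Qed.

Lemma scale_gbasis_inj (c d : F) (g h : G) :
  c *: gbasis F g = d *: gbasis F h -> c = d /\ (c = 0 \/ g = h).
Proof.
move=> E; have [gh|gh] := eqVneq g h.
  split; last by right.
  by move/(congr1 (mcoeff g)): E; rewrite gh !mcoeffZ !mcoeffUU !mulr1.
have c0 : c = 0.
  move/(congr1 (mcoeff g)): E; rewrite !mcoeffZ mcoeffUU mcoeffU eq_sym.
  by rewrite (negbTE gh) mulr0 mulr1.
split; last by left.
by rewrite c0; move: E; rewrite c0 scale0r => /esym/scale_gbasis_eq0.
Qed.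

Lemma mem_std (c : F) (g : G) : c *: gbasis F g \in std_grading F G g.
Proof. by apply/std_componentP; exists c. Qed.

Lemma amul_scale_gbasis (c d : F) (g h : G) :
  amul (c *: gbasis F g) (d *: gbasis F h) = (c * d) *: gbasis F (g * h)%g.
Proof.
by rewrite amulZl amulZr scalerA; congr (_ *: _); apply: galg_mul_basis.
Qed.

End Basis.

Lemma group_morph1 (K L : groupType) (pi : K -> L) :
  {morph pi : k l / (k * l)%g >-> (k * l)%g} -> pi 1%g = 1%g.
Proof. by move=> piM; apply: (mulgI (pi 1%g)); rewrite -piM !mulg1. Qed.

(** Both projections of the product are of this form, with [chi] the
    projection onto [F^x] for the first one and [chi] trivial for the second
    one.  Injectivity on components holds because [chi] takes its values in
    the nonzero scalars. *)
Lemma twisted_galg_hom (F : fieldType) (K G : groupType)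
    (chi : K -> funit F) (pi : K -> G) :
  {morph chi : k l / (k * l)%g >-> (k * l)%g} ->
  {morph pi : k l / (k * l)%g >-> (k * l)%g} ->
  exists p : galg F K -> galg F G,
    [/\ graded_injective (std_grading F K) (std_grading F G) p,
        p aone = aone &
        forall c k, p (c *: gbasis F k) = (c * val (chi k)) *: gbasis F (pi k)].
Proof.
move=> chiM piM.
pose phi k (x : galg F K) : galg F G := (x@_k * val (chi k)) *: gbasis F (pi k).
have phiE k c : phi k (c *: gbasis F k) = (c * val (chi k)) *: gbasis F (pi k).
  by rewrite /phi mcoeffZ mcoeffUU mulr1.
have [] := @grading_extension _ _ _ (std_grading F K) (galg F G) phi.
- by move=> k c x y; rewrite /phi mcoeffD mcoeffZ mulrDl scalerDl scalerA mulrA.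
- move=> k l _ _ /std_componentP[c ->] /std_componentP[d ->].
  rewrite (amul_scale_gbasis c d k l) !phiE amul_scale_gbasis chiM piM.
  by rewrite mulrACA.
move=> p [[plin pmul] pE].
have pbasis c k : p (c *: gbasis F k) = (c * val (chi k)) *: gbasis F (pi k).
  by rewrite (pE k) ?phiE // mem_std.
exists p; split=> //; last first.
  have := pbasis 1 1%g; rewrite scale1r mul1r (group_morph1 chiM) scale1r.
  by rewrite (group_morph1 piM).
split=> //; split=> k.
  by exists (pi k) => _ /std_componentP[c ->]; rewrite pbasis mem_std.
move=> _ _ /std_componentP[c ->] /std_componentP[d ->].
by rewrite !pbasis => /scale_gbasis_inj[/(mulIf (valP (chi k)))->].
Qed.

(** If [x] is homogeneous with [u x = c u_t] nonzero, then
    [u x * u 1 = u x], and [u x] can be cancelled because [u_t] is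
    invertible. *)
Lemma graded_injective_unital (F : fieldType) (X : unitalAlgType F)
    (K T : groupType) (GX : grading X K) (u : X -> galg F T) :
  graded_injective GX (std_grading F T) u -> u aone != 0 -> u aone = aone.
Proof.
move=> [[ulin umul] [ugr uinj]] u1.
have [k [x [Xx x0]]] : exists k x, x \in GX k /\ u x != 0.
  apply: NNPP => noX; case/eqP: u1.
  have {}noX k x : x \in GX k -> u x = 0.
    move=> Xx; have [//|ux] := eqVneq (u x) 0.
    by case: noX; exists k, x.
  apply: (linear_eq_homogeneous (GA := GX) (g := fun=> 0) ulin _ noX).
  by move=> c a b; rewrite scaler0 addr0.
have [t ut] := ugr k; have /std_componentP[c ux] := ut _ Xx.
have c0 : c != 0 by apply: contra_neq x0 => c0; rewrite ux c0 scale0r.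
have E : amul (gbasis F t) (u aone) = gbasis F t.
  apply: (scalerI c0); rewrite -amulZl -ux -umul amula1; exact.
rewrite -[LHS]amul1a.
have -> : aone = amul (gbasis F (t^-1)%g) (gbasis F t) :> galg F T.
  by rewrite -[RHS]/(galg_mul _ _) galg_mul_basis mulVg.
by rewrite -amulA E.
Qed.

(** * The product of two group algebras *)

(** A group [T] with coordinates [chi], [pi1] and [pi2] that identify it with
    [F^x * G * H]. *)
Section Product.
Variables (F : fieldType) (G H T : groupType).
Variables (chi : T -> funit F) (pi1 : T -> G) (pi2 : T -> H).
Hypothesis chiM : {morph chi : s t / (s * t)%g >-> (s * t)%g}.
Hypothesis pi1M : {morph pi1 : s t / (s * t)%g >-> (s * t)%g}.
Hypothesis pi2M : {morph pi2 : s t / (s * t)%g >-> (s * t)%g}.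
Hypothesis T_inj : forall s t,
  chi s = chi t -> pi1 s = pi1 t -> pi2 s = pi2 t -> s = t.
Hypothesis T_surj : forall a g h,
  exists t, [/\ chi t = a, pi1 t = g & pi2 t = h].

Section Cone.
Variables (p1 : galg F T -> galg F G) (p2 : galg F T -> galg F H).
Hypothesis p1hom : graded_injective (std_grading F T) (std_grading F G) p1.
Hypothesis p2hom : graded_injective (std_grading F T) (std_grading F H) p2.
Hypothesis p1E : forall c t,
  p1 (c *: gbasis F t) = (c * val (chi t)) *: gbasis F (pi1 t).
Hypothesis p2E : forall c t, p2 (c *: gbasis F t) = c *: gbasis F (pi2 t).

(** The degrees [s] and [t] may be different a priori, so this also
    determines the degree of a nonzero homogeneous element.  Homogeneity is
    essential: with [w h = u_(1, g, h) - u_(1, g', h)], the difference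
    [w h - w h'] is killed by both [p1] and [p2]. *)
Lemma homogeneous_jointly_monic (s t : T) (x y : galg F T) :
  x \in std_grading F T s -> y \in std_grading F T t ->
  p1 x = p1 y -> p2 x = p2 y -> x = y.
Proof.
move=> /std_componentP[c ->] /std_componentP[d ->].
rewrite !p1E !p2E => E1 /scale_gbasis_inj[E2]; rewrite -{}E2 in E1 *.
have [-> _|c0] := eqVneq c 0; first by rewrite !scale0r.
move=> [E|pi2st]; first by rewrite E eqxx in c0.
have [chist [E|pi1st]] := scale_gbasis_inj E1.
  by have := mulf_neq0 c0 (valP (chi s)); rewrite E eqxx.
by rewrite (T_inj (val_inj (mulfI c0 chist)) pi1st pi2st).
Qed.

Section Factorization.
Variables (X : assocAlgType F) (K : groupType) (GX : grading X K).

Lemma factorization_unique (u v : X -> galg F T) :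
  graded_injective GX (std_grading F T) u ->
  graded_injective GX (std_grading F T) v ->
  p1 \o u =1 p1 \o v -> p2 \o u =1 p2 \o v -> u =1 v.
Proof.
move=> [[ulin _] [ugr _]] [[vlin _] [vgr _]] E1 E2.
apply: (linear_eq_homogeneous (GA := GX)) => // k x Xx.
have [s us] := ugr k; have [t vt] := vgr k.
exact: (homogeneous_jointly_monic (us _ Xx) (vt _ Xx) (E1 x) (E2 x)).
Qed.

Variables (f : X -> galg F G) (g : X -> galg F H).
Hypothesis fhom : graded_injective GX (std_grading F G) f.
Hypothesis ghom : graded_injective GX (std_grading F H) g.

(** For a nonzero component, [t] has the ratio of the two images of an element
    [x0] as first coordinate; as [f] is injective there, every other element
    is a multiple of [x0].  For a zero component any degree will do. *)
Lemma component_degree k : exists t : T, forall x, x \in GX k ->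
  exists c, f x = p1 (c *: gbasis F t) /\ g x = p2 (c *: gbasis F t).
Proof.
have [[flin _] [fgr finj]] := fhom; have [[glin _] [ggr ginj]] := ghom.
have [f0 _ fZ] := linear_props flin; have [g0 _ gZ] := linear_props glin.
have [[x0 [Xx0 x0n0]]|X0] := classic (exists x, x \in GX k /\ x != 0); last first.
  exists 1%g => x Xx; exists 0; rewrite p1E p2E mul0r !scale0r.
  have [-> //|xn0] := eqVneq x 0.
  by case: X0; exists x.
have [i fi] := fgr k; have [j gj] := ggr k.
have /std_componentP[a fx0] := fi _ Xx0; have /std_componentP[b gx0] := gj _ Xx0.
have a0 : a != 0.
  apply: contra_neq x0n0 => a0; apply: (finj k) => //; first exact: component0.
  by rewrite fx0 a0 scale0r f0.
have b0 : b != 0.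
  apply: contra_neq x0n0 => b0; apply: (ginj k) => //; first exact: component0.
  by rewrite gx0 b0 scale0r g0.
pose r : funit F := exist _ (a / b) (mulf_neq0 a0 (invr_neq0 b0)).
have [t [chit pi1t pi2t]] := T_surj r i j.
exists t => x Xx.
have /std_componentP[c fx] := fi _ Xx.
have {Xx} -> : x = (c / a) *: x0.
  apply: (finj k) => //; first exact: componentZ.
  by rewrite fx fZ fx0 scalerA divfK.
exists (c / a * b); rewrite p1E p2E fZ gZ fx0 gx0 !scalerA chit pi1t pi2t.
by rewrite -(mulrA (c / a) b) (mulrC b) (divfK b0).
Qed.

Lemma factorization_exists : exists u : X -> galg F T,
  [/\ graded_injective GX (std_grading F T) u, p1 \o u =1 f & p2 \o u =1 g].
Proof.
have [[flin fmul] [fgr finj]] := fhom; have [[glin gmul] [ggr ginj]] := ghom.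
have [[p1lin p1mul] _] := p1hom; have [[p2lin p2mul] _] := p2hom.
have [t tP] := functional_choice _ component_degree.
(* On the component of degree k the coefficient is read off from g, since p2
   preserves coefficients. *)
pose phi k x : galg F T := (g x)@_(pi2 (t k)) *: gbasis F (t k).
have phi_mem k x : phi k x \in std_grading F T (t k) by apply: mem_std.
have phiP k x : x \in GX k -> p1 (phi k x) = f x /\ p2 (phi k x) = g x.
  move=> /tP[c [-> gx]]; rewrite /phi gx p2E.
  by rewrite mcoeffZ mcoeffUU mulr1 p2E.
have [] := @grading_extension _ _ _ GX (galg F T) phi.
- by move=> k c x y; rewrite /phi glin mcoeffD mcoeffZ scalerDl scalerA.
- move=> k l x y Xx Xy; have [f1 g1] := phiP _ _ Xx; have [f2 g2] := phiP _ _ Xy.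
  have [f3 g3] := phiP _ _ (component_mul Xx Xy).
  apply: (homogeneous_jointly_monic (phi_mem _ _)).
  + exact: component_mul (phi_mem k x) (phi_mem l y).
  + by rewrite p1mul f1 f2 f3.
  + by rewrite p2mul g1 g2 g3.
move=> u [[ulin umul] uE].
have p1u : p1 \o u =1 f.
  apply: (linear_eq_homogeneous (GA := GX)) => // [c x y|k x Xx] /=.
    by rewrite ulin p1lin.
  by rewrite (uE k) //; case: (phiP k x Xx).
have p2u : p2 \o u =1 g.
  apply: (linear_eq_homogeneous (GA := GX)) => // [c x y|k x Xx] /=.
    by rewrite ulin p2lin.
  by rewrite (uE k) //; case: (phiP k x Xx).
exists u; split=> //; split=> //; split=> k.
  by exists (t k) => x Xx; rewrite (uE k).
by move=> x y Xx Xy uxy; apply: (finj k) => //; rewrite -!p1u /= uxy.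
Qed.

End Factorization.

End Cone.

Lemma galg_projections : exists p1 p2,
  [/\ graded_injective (std_grading F T) (std_grading F G) p1 /\
      graded_injective (std_grading F T) (std_grading F H) p2,
      p1 aone = aone /\ p2 aone = aone,
      forall c t, p1 (c *: gbasis F t) = (c * val (chi t)) *: gbasis F (pi1 t) &
      forall c t, p2 (c *: gbasis F t) = c *: gbasis F (pi2 t)].
Proof.
have [p1 [p1hom p1one p1E]] := twisted_galg_hom chiM pi1M.
have trivM : {morph (fun=> 1%g : funit F) : s t / (s * t : T)%g >-> (s * t)%g}.
  by move=> s t; rewrite mulg1.
have [p2 [p2hom p2one p2E]] := twisted_galg_hom trivM pi2M.
exists p1, p2; split=> // c t.
by rewrite p2E mulr1.
Qed.

Lemma galg_is_product :
  is_product (group_grAlg F G) (group_grAlg F H) (group_grAlg F T).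
Proof.
have [p1 [p2 [[p1hom p2hom] _ p1E p2E]]] := galg_projections.
exists (exist _ p1 p1hom), (exist _ p2 p2hom) => X [f fhom] [g ghom].
have [u [uhom p1u p2u]] := factorization_exists p1hom p2hom p1E p2E fhom ghom.
exists (exist _ u uhom); split.
  by split; apply: subset_eq_compat; apply: functional_extensionality.
move=> [v vhom] [/(congr1 sval)/= p1v /(congr1 sval)/= p2v].
apply: subset_eq_compat; apply: functional_extensionality.
apply: (factorization_unique p1E p2E uhom vhom) => x.
  by rewrite p1u -p1v.
by rewrite p2u -p2v.
Qed.

Lemma galg_is_product_unital :
  is_product (group_grAlg1 F G) (group_grAlg1 F H) (group_grAlg1 F T).
Proof.
have [p1 [p2 [[p1hom p2hom] [p1one p2one] p1E p2E]]] := galg_projections.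
exists (exist _ p1 (conj p1hom p1one)), (exist _ p2 (conj p2hom p2one)).
move=> X [f [fhom f1]] [g [ghom g1]].
have [u [uhom p1u p2u]] := factorization_exists p1hom p2hom p1E p2E fhom ghom.
have u1 : u aone = aone.
  apply: graded_injective_unital uhom _; apply/eqP => u0.
  have := p2u aone; rewrite /= u0 g1 -(scale0r (gbasis F (1%g : T))) p2E.
  rewrite scale0r -[aone]scale1r => /esym/scale_gbasis_eq0/eqP.
  by rewrite oner_eq0.
exists (exist _ u (conj uhom u1)); split.
  by split; apply: subset_eq_compat; apply: functional_extensionality.
move=> [v [vhom v1]] [/(congr1 sval)/= p1v /(congr1 sval)/= p2v].
apply: subset_eq_compat; apply: functional_extensionality.
apply: (factorization_unique p1E p2E uhom vhom) => x.
  by rewrite p1u -p1v.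
by rewrite p2u -p2v.
Qed.

End Product.

Theorem proposition6p1 (F : fieldType) (G H : groupType) :
  is_product (group_grAlg F G) (group_grAlg F H)
             (group_grAlg F (funit F * G * H)%type) /\
  is_product (group_grAlg1 F G) (group_grAlg1 F H)
             (group_grAlg1 F (funit F * G * H)%type).
Proof.
pose T : groupType := (funit F * G * H)%type.
have T_inj (s t : T) : s.1.1 = t.1.1 -> s.1.2 = t.1.2 -> s.2 = t.2 -> s = t.
  by case: s t => [[a g] h] [[b g'] h'] /= -> -> ->.
have T_surj a g h : exists t : T, [/\ t.1.1 = a, t.1.2 = g & t.2 = h].
  by exists (a, g, h).
by split; [apply: galg_is_product T_inj T_surj
          |apply: galg_is_product_unital T_inj T_surj].
Qed.
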